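(* Let $s$ be a complex number and suppose that the differential equation $(\flat_s)$ has a solution of CFT type. Then $s$ is one of the following $23$ numbers: $$-\tfrac{318}{5},-\tfrac{198}{5},-\tfrac{138}{5},-\tfrac{78}{5},-\tfrac{48}{5},-\tfrac{38}{5},-\tfrac{18}{5},-\tfrac{6}{5},-\tfrac{3}{5},\tfrac{2}{5},\tfrac{6}{5},\tfrac{12}{5},\tfrac{18}{5},\tfrac{22}{5},\tfrac{27}{5},6,\tfrac{32}{5},\tfrac{54}{5},\tfrac{42}{5},18,-\tfrac{66}{5},-6,-\tfrac{8}{5}.$$
   Context: Notation. $q=e^{2\pi i\tau}$ with $\tau\in\mathbb{H}$, $D=q\frac{d}{dq}$, and $E_k$ is the normalized Eisenstein series of weight $k$ (constant term $1$). For $s\in\mathbb{C}$, $(\flat_s)$ is the modular linear differential equation of order 4 and weight 0 $$D^4(f)-E_2D^3(f)+(3D(E_2)+\alpha_1(s)E_4)D^2(f)-\Bigl(D^2(E_2)+\tfrac{\alpha_1(s)}{2}D(E_4)-\alpha_2(s)E_6\Bigr)D(f)+\alpha_3(s)E_8f=0,$$ with $\alpha_1(s)=\frac{-25s^2+120s+1332}{7200}$, $\alpha_2(s)=\frac{(5s+6)^2}{14400}$, $\alpha_3(s)=\frac{(s-18)(s+6)(5s+6)^2}{8294400}$. A function $f$ on $\mathbb{H}$ is of CFT type if it has a $q$-expansion $f(\tau)=q^\alpha\bigl(1+\sum_{n=1}^\infty a_nq^n\bigr)$ with $\alpha\in\mathbb{Q}$ and $a_n\in\mathbb{Z}_{\ge0}$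 for all $n\ge1$. *)

(* Defs.v *)
(* Stdlib reals with Coquelicot; functions on the upper half-plane are total
   functions C -> C whose values off the half-plane are never used. *)
From Stdlib Require Import Reals ZArith QArith Qreals List.
From Coquelicot Require Import Coquelicot.

Open Scope C_scope.

Definition upper_half_plane (tau : C) : Prop := (0 < Im tau)%R.

Definition Cexp (z : C) : C :=
  ((exp (Re z) * cos (Im z))%R, (exp (Re z) * sin (Im z))%R).

(* q^r is the branch e^(2 pi i r tau); no complex logarithm is involved. *)
Definition qpow (r : R) (tau : C) : C :=
  Cexp (RtoC (2 * PI * r) * Ci * tau).

Definition nome (tau : C) : C := qpow 1 tau.

(* qD = q d/dq = (2 pi i)^(-1) d/dtau. Coquelicot's C_derive is a limit along
   the horizontal direction only: it agrees with the complex derivative at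
   points of complex differentiability. *)
Definition qD (f : C -> C) (tau : C) : C :=
  C_derive f tau / (RtoC (2 * PI) * Ci).

Definition qDn (k : nat) (f : C -> C) : C -> C := Nat.iter k qD f.

Definition holomorphic_on_H (f : C -> C) : Prop :=
  forall tau : C, upper_half_plane tau ->
    ex_derive (K := C_AbsRing) (V := C_NormedModule) f tau.

Definition CSeries (u : nat -> C) : C :=
  (Series (fun n => Re (u n)), Series (fun n => Im (u n))).

Definition divisors (n : nat) : list nat :=
  filter (fun d => Nat.eqb (Nat.modulo n d) 0) (seq 1 n).

Definition divisor_sigma (k n : nat) : Z :=
  fold_right Z.add 0%Z
    (map (fun d => Z.pow (Z.of_nat d) (Z.of_nat k)) (divisors n)).

Definition eisenstein_series (k : nat) (c : Z) (tau : C) : C :=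
  1 + RtoC (IZR c) *
      CSeries (fun n => RtoC (IZR (divisor_sigma (k - 1) (S n))) * nome tau ^ S n).

(* The normalized Eisenstein series, with factors -2k / B_k, with B_2 = 1/6, B_4 = -1/30, B_6 = 1/42 and
   B_8 = -1/30. *)
Definition E2 : C -> C := eisenstein_series 2 (-24).
Definition E4 : C -> C := eisenstein_series 4 240.
Definition E6 : C -> C := eisenstein_series 6 (-504).
Definition E8 : C -> C := eisenstein_series 8 480.

Definition alpha1 (s : C) : C := (- 25 * s ^ 2 + 120 * s + 1332) / 7200.
Definition alpha2 (s : C) : C := (5 * s + 6) ^ 2 / 14400.
Definition alpha3 (s : C) : C :=
  (s - 18) * (s + 6) * (5 * s + 6) ^ 2 / 8294400.

Definition flat_lhs (s : C) (f : C -> C) (tau : C) : C :=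
  qDn 4 f tau
  - E2 tau * qDn 3 f tau
  + (3 * qD E2 tau + alpha1 s * E4 tau) * qDn 2 f tau
  - (qDn 2 E2 tau + alpha1 s / 2 * qD E4 tau - alpha2 s * E6 tau) * qD f tau
  + alpha3 s * E8 tau * f tau.

(* The differentiability of f, qD f, qDn 2 f and qDn 3 f makes every qDn k f in
   the equation a genuine complex derivative. *)
Definition flat_solution (s : C) (f : C -> C) : Prop :=
  (forall k : nat, (k < 4)%nat -> holomorphic_on_H (qDn k f)) /\
  (forall tau : C, upper_half_plane tau -> flat_lhs s f tau = 0).

(* a n is the coefficient a_n for n >= 1; a 0 is not used. *)
Definition CFT_type (f : C -> C) : Prop :=
  exists (alpha : Q) (a : nat -> nat),
    forall tau : C, upper_half_plane tau ->
      exists l : C,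
        is_series (K := C_AbsRing) (V := C_NormedModule)
          (fun n => RtoC (INR (a (S n))) * nome tau ^ S n) l /\
        f tau = qpow (Q2R alpha) tau * (1 + l).

(* Main.v *)
Require Import Defs.
From Stdlib Require Import Reals List.
From Coquelicot Require Import Coquelicot.
From Stdlib Require Import ZArith QArith Qreals Lra Lia.
From Stdlib Require Qcanon.

(** Write f = sum a_n q^(alpha+n) and let x = 5s. Restricting the equation to the imaginary axis
    turns it into an identity of real power series in r = |q|, hence into a recurrence for the a_n.
    - Degree 0 is the indicial equation; its four roots are affine in s with rational coefficients,
      so s is rational.
    - Degree 1 expresses a_1 through s. On each of the four branches one linear factor of the
      indicial polynomial cancels (its root is an admissible s), and what remains says that an
      affine function z of s is a root of a quadratic Z^2 + b Z + c with integer b depending on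
      a_1 and with constant c = 180, 2880, 4200 or 100800. So z is an integer dividing c.
    - This leaves finitely many s; for each inadmissible one the recurrence produces, within the
      first 32 coefficients, one that is not a nonnegative integer or does not exist. *)

Open Scope R_scope.

(** * Termwise differentiation of trigonometric series *)


(** Two mean value steps: the increment of [cos] is -v sin xi, and sin xi - sin u is (xi - u) cos
    eta with |xi - u| <= |v|. The bound does not depend on u, so it can be summed over the terms of
    a series. *)
Lemma cos_taylor1_le (u v : R) : Rabs (cos (u + v) - cos u + v * sin u) <= v ^ 2.
Proof.
destruct (MVT_gen cos u (u + v) (fun x => - sin x)) as [xi [Hxi E1]].
- intros x _. auto_derive; [easy | ring].
- intros x _. apply continuity_pt_filterlim, continuous_cos.
destruct (MVT_gen sin u xi cos) as [eta [_ E2]].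
- intros x _. auto_derive; [easy | ring].
- intros x _. apply continuity_pt_filterlim, continuous_sin.
replace (cos (u + v) - cos u + v * sin u) with (- (v * ((xi - u) * cos eta)))
  by (rewrite E1; replace (u + v - u) with v by ring; rewrite Rmult_comm in E2; nra).
rewrite Rabs_Ropp, !Rabs_mult.
assert (H1 : Rabs (xi - u) <= Rabs v).
{ revert Hxi. unfold Rmin, Rmax. destruct (Rle_dec u (u + v)); intros;
  unfold Rabs; repeat destruct Rcase_abs; lra. }
assert (H2 : Rabs (cos eta) <= 1) by (apply Rabs_le; pose proof (COS_bound eta); lra).
rewrite <- (pow2_abs v).
pose proof (Rabs_pos (cos eta)); pose proof (Rabs_pos (xi - u)); pose proof (Rabs_pos v).
assert (Rabs (xi - u) * Rabs (cos eta) <= Rabs v) by nra.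
simpl. nra.
Qed.

Lemma is_derive_of_quadratic_error (f : R -> R) (x l K : R) :
  (forall h, Rabs (f (x + h) - f x - h * l) <= K * h ^ 2) -> is_derive f x l.
Proof.
intros H. apply is_derive_Reals. intros eps Heps.
assert (HK : 0 <= K) by (generalize (H 1) (Rabs_pos (f (x + 1) - f x - 1 * l)); lra).
assert (Hd : 0 < eps / (K + 1)) by (apply Rdiv_lt_0_compat; lra).
exists (mkposreal _ Hd). simpl. intros h Hh Hlt.
replace ((f (x + h) - f x) / h - l) with ((f (x + h) - f x - h * l) / h) by (field; easy).
unfold Rdiv. rewrite Rabs_mult, Rabs_inv.
assert (Hp : 0 < Rabs h) by (apply Rabs_pos_lt; easy).
apply Rmult_lt_reg_r with (Rabs h); [easy |].
rewrite Rmult_assoc, Rinv_l, Rmult_1_r by lra.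
apply Rle_lt_trans with (1 := H h). rewrite <- (pow2_abs h).
assert (Rabs h * (K + 1) < eps).
{ apply Rmult_lt_reg_r with (/ (K + 1)); [apply Rinv_0_lt_compat; lra |].
  rewrite Rmult_assoc, Rinv_r by lra. fold (Rdiv eps (K + 1)). lra. }
simpl. nra.
Qed.

Lemma Series_norm_le (a b : nat -> R) :
  (forall n, Rabs (a n) <= b n) -> ex_series b -> Rabs (Series a) <= Series b.
Proof.
intros H Hb.
apply Rle_trans with (Series (fun n => Rabs (a n))).
- apply Series_Rabs. apply (ex_series_le (fun n => Rabs (a n)) b); [| easy].
  intros n. unfold norm; simpl. unfold abs; simpl. rewrite Rabs_Rabsolu. apply H.
- apply Series_le; [| easy]. intros n; split; [apply Rabs_pos | apply H].
Qed.

(** The n-th term has linearization error at most |b n| (lam n h)^2. The third hypothesis makes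
    these errors summable, so the whole series has error O(h^2), and no uniform convergence argument
    is needed. The phases [phi] let the same statement cover sines. *)
Lemma is_derive_trig_series (b lam phi : nat -> R) (x : R) :
  ex_series (fun n => Rabs (b n)) ->
  ex_series (fun n => Rabs (lam n * b n)) ->
  ex_series (fun n => Rabs (lam n * (lam n * b n))) ->
  is_derive (fun x => Series (fun n => b n * cos (lam n * x + phi n))) x
    (Series (fun n => - (lam n * b n * sin (lam n * x + phi n)))).
Proof.
intros H0 H1 H2.
assert (bnd : forall (c : nat -> R) (t : nat -> R), (forall n, Rabs (t n) <= 1) ->
  ex_series (fun n => Rabs (c n)) -> ex_series (fun n => c n * t n)).
{ intros c t Ht Hc. apply (ex_series_le (fun n => c n * t n) (fun n => Rabs (c n))); [| easy].
  intros n. unfold norm; simpl; unfold abs; simpl. rewrite Rabs_mult.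
  specialize (Ht n). pose proof (Rabs_pos (c n)). pose proof (Rabs_pos (t n)). nra. }
assert (Hcos : forall u, Rabs (cos u) <= 1) by
  (intros u; apply Rabs_le; pose proof (COS_bound u); lra).
assert (Hsin : forall u, Rabs (- sin u) <= 1) by
  (intros u; apply Rabs_le; pose proof (SIN_bound u); lra).
apply is_derive_of_quadratic_error with
  (K := Series (fun n => Rabs (lam n * (lam n * b n)))).
intros h.
assert (C : forall y, ex_series (fun n => b n * cos (lam n * y + phi n))) by
  (intros y; apply bnd; auto).
assert (D : ex_series (fun n => h * - (lam n * b n * sin (lam n * x + phi n)))).
{ apply (ex_series_scal (V := R_NormedModule) h
    (fun n => - (lam n * b n * sin (lam n * x + phi n)))). apply (ex_series_ext (fun n => lam n * b n * - sin (lam n * x + phi n))).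
  intros n; simpl; ring. apply bnd; auto. }
rewrite <- Series_scal_l, <- Series_minus, <- Series_minus by
  (try apply (ex_series_minus (fun n => b n * cos (lam n * (x + h) + phi n))
     (fun n => b n * cos (lam n * x + phi n))); auto).
rewrite <- Series_scal_r.
apply Series_norm_le; [| apply ex_series_scal_r, H2].
intros n.
replace (b n * cos (lam n * (x + h) + phi n) - b n * cos (lam n * x + phi n) -
  h * - (lam n * b n * sin (lam n * x + phi n)))
  with (b n * (cos ((lam n * x + phi n) + lam n * h) - cos (lam n * x + phi n)
     + (lam n * h) * sin (lam n * x + phi n)))
  by (replace (lam n * (x + h) + phi n) with ((lam n * x + phi n) + lam n * h) by ring; ring).
rewrite Rabs_mult.
apply Rle_trans with (Rabs (b n) * (lam n * h) ^ 2).
- apply Rmult_le_compat_l; [apply Rabs_pos | apply cos_taylor1_le].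
- right. rewrite !Rabs_mult. rewrite Rpow_mult_distr, <- (pow2_abs (lam n)). ring.
Qed.

(** * Coefficient sequences of power series on the unit disc *)

(* Equivalently, the power series of [c] has radius of convergence at least 1. *)
Definition subexponential (c : nat -> R) : Prop :=
  forall r, 0 < r < 1 -> exists M, forall n, Rabs (c n) * r ^ n <= M.

(** (1 - rho^n) / (1 - rho) is a sum of n powers of rho, each at least rho^n. *)
Lemma INR_mul_pow_le (rho : R) (n : nat) :
  0 <= rho < 1 -> INR n * rho ^ n <= / (1 - rho).
Proof.
intros H.
assert (A : INR n * rho ^ n * (1 - rho) <= 1 - rho ^ n).
{ induction n as [| n IH]; [simpl; lra |].
  rewrite S_INR. simpl.
  assert (0 <= rho ^ n <= 1).
  { split; [apply pow_le; lra |]. rewrite <- (pow1 n). apply pow_incr; lra. }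
  set (p := rho ^ n) in *.
  assert (rho * (INR n * p * (1 - rho)) <= rho * (1 - p)) by (apply Rmult_le_compat_l; lra).
  assert (0 <= (1 - rho) * (1 - rho * p)) by (apply Rmult_le_pos; nra).
  nra. }
assert (0 <= rho ^ n) by (apply pow_le; lra).
apply Rmult_le_reg_r with (1 - rho); [lra |]. rewrite Rinv_l by lra. lra.
Qed.

Lemma subexponential_const (k : R) : subexponential (fun _ => k).
Proof.
intros r Hr. exists (Rabs k). intros n.
assert (r ^ n <= 1) by (rewrite <- (pow1 n); apply pow_incr; lra).
pose proof (Rabs_pos k). nra.
Qed.

Lemma subexponential_le (c d : nat -> R) :
  (forall n, Rabs (c n) <= Rabs (d n)) -> subexponential d -> subexponential c.
Proof.
intros H Hd r Hr. destruct (Hd r Hr) as [M HM]. exists M. intros n.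
apply Rle_trans with (2 := HM n). apply Rmult_le_compat_r; [apply pow_le; lra | apply H].
Qed.

Lemma subexponential_ext (c d : nat -> R) :
  (forall n, c n = d n) -> subexponential d -> subexponential c.
Proof. intros H. apply subexponential_le. intros n. rewrite H. apply Rle_refl. Qed.

Lemma subexponential_plus (c d : nat -> R) :
  subexponential c -> subexponential d -> subexponential (fun n => c n + d n).
Proof.
intros Hc Hd r Hr. destruct (Hc r Hr) as [M HM]. destruct (Hd r Hr) as [N HN].
exists (M + N). intros n. specialize (HM n). specialize (HN n).
pose proof (Rabs_triang (c n) (d n)). assert (0 <= r ^ n) by (apply pow_le; lra). nra.
Qed.

Lemma subexponential_scal (k : R) (c : nat -> R) :
  subexponential c -> subexponential (fun n => k * c n).
Proof.
intros Hc r Hr. destruct (Hc r Hr) as [M HM]. exists (Rabs k * M). intros n.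
rewrite Rabs_mult. specialize (HM n). pose proof (Rabs_pos k). nra.
Qed.

Lemma subexponential_mul_INR (c : nat -> R) :
  subexponential c -> subexponential (fun n => INR n * c n).
Proof.
(* The bound is taken at the midpoint r' of r and 1; the spare factor (r / r')^n absorbs n. *)
intros Hc r Hr. set (r' := (r + 1) / 2). assert (Hr' : 0 < r' < 1) by (unfold r'; lra).
destruct (Hc r' Hr') as [M HM].
assert (Hrho : 0 <= r / r' < 1).
{ split; [apply Rdiv_le_0_compat; lra |]. apply Rmult_lt_reg_r with r'; [lra |].
  unfold Rdiv. rewrite Rmult_assoc, Rinv_l; unfold r'; lra. }
exists (M * / (1 - r / r')). intros n.
replace r with (r' * (r / r')) by (field; lra).
rewrite Rpow_mult_distr.
replace (r' * (r / r') / r') with (r / r') by (field; lra).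
rewrite Rabs_mult, (Rabs_pos_eq (INR n)) by apply pos_INR.
replace (INR n * Rabs (c n) * (r' ^ n * (r / r') ^ n))
  with ((Rabs (c n) * r' ^ n) * (INR n * (r / r') ^ n)) by ring.
apply Rmult_le_compat; auto using INR_mul_pow_le.
- apply Rmult_le_pos; [apply Rabs_pos | apply pow_le; lra].
- apply Rmult_le_pos; [apply pos_INR | apply pow_le; lra].
Qed.

Lemma subexponential_ex_series (c : nat -> R) (r : R) :
  subexponential c -> 0 < r < 1 -> ex_series (fun n => Rabs (c n * r ^ n)).
Proof.
intros Hc Hr. set (r' := (r + 1) / 2). assert (Hr' : 0 < r' < 1) by (unfold r'; lra).
destruct (Hc r' Hr') as [M HM].
assert (Hrho : 0 <= r / r' < 1).
{ split; [apply Rdiv_le_0_compat; lra |]. apply Rmult_lt_reg_r with r'; [lra |].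
  unfold Rdiv. rewrite Rmult_assoc, Rinv_l; unfold r'; lra. }
apply (ex_series_le (fun n => Rabs (c n * r ^ n)) (fun n => M * (r / r') ^ n)).
- intros n. unfold norm; simpl; unfold abs; simpl.
  rewrite Rabs_Rabsolu, Rabs_mult, (Rabs_pos_eq (r ^ n)) by (apply pow_le; lra).
  replace (r ^ n) with (r' ^ n * (r / r') ^ n)
    by (rewrite <- Rpow_mult_distr; f_equal; field; lra).
  rewrite <- Rmult_assoc. apply Rmult_le_compat_r; [apply pow_le; lra | apply HM].
- apply (ex_series_scal (V := R_NormedModule) M (fun n => (r / r') ^ n)). apply ex_series_geom. rewrite Rabs_pos_eq; lra.
Qed.

Lemma subexponential_CV_radius (c : nat -> R) (x : R) :
  subexponential c -> Rabs x < 1 -> Rbar_lt (Rabs x) (CV_radius c).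
Proof.
intros Hc Hx. set (r' := (Rabs x + 1) / 2).
pose proof (Rabs_pos x).
assert (Hr' : 0 < r' < 1) by (unfold r'; lra).
apply Rbar_lt_le_trans with r'; [simpl; unfold r'; lra |].
destruct (CV_radius_bounded c) as [Hub _]. apply Hub.
destruct (Hc r' Hr') as [M HM]. exists M. intros n.
rewrite Rabs_mult, (Rabs_pos_eq (r' ^ n)) by (apply pow_le; lra). apply HM.
Qed.

Lemma subexponential_decr_1 (c : nat -> R) :
  subexponential c -> subexponential (PS_decr_1 c).
Proof.
intros Hc r Hr. destruct (Hc r Hr) as [M HM]. exists (M / r). intros n.
specialize (HM (S n)). unfold PS_decr_1. simpl in HM.
apply Rmult_le_reg_r with r; [lra |]. replace (M / r * r) with M by (field; lra). lra.
Qed.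

(** Vanishing is assumed only to the right of 0. Continuity at 0 kills the constant term; since r is
    nonzero, the shifted series vanishes on the same interval, and induction gives the rest. *)
Lemma PSeries_eq_0 (c : nat -> R) :
  subexponential c -> (forall r, 0 < r < 1 -> PSeries c r = 0) -> forall n, c n = 0.
Proof.
intros Hc H n. revert c Hc H.
assert (H0 : forall c, subexponential c -> (forall r, 0 < r < 1 -> PSeries c r = 0) -> c 0%nat = 0).
{ intros c Hc H. rewrite <- PSeries_0.
  destruct (Req_dec (PSeries c 0) 0) as [E | E]; [easy | exfalso].
  assert (Hcont := PSeries_continuity c 0 (subexponential_CV_radius c 0 Hc
    ltac:(rewrite Rabs_R0; lra))).
  destruct (Hcont (Rabs (PSeries c 0)) (Rabs_pos_lt _ E)) as [d [Hd Hlim]].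
  set (x := Rmin (d / 2) (1 / 2)).
  assert (Hx : 0 < x < 1 /\ x < d).
  { unfold x, Rmin. destruct Rle_dec; lra. }
  specialize (Hlim x). simpl in Hlim. unfold Rdist in Hlim.
  rewrite (H x) in Hlim by lra. unfold Rminus in Hlim. rewrite Rplus_0_l, Rabs_Ropp in Hlim.
  rewrite Ropp_0, Rplus_0_r, Rabs_pos_eq in Hlim by lra.
  assert (Rabs (PSeries c 0) < Rabs (PSeries c 0)); [| lra].
  apply Hlim. repeat split; lra. }
induction n as [| n IH]; intros c Hc H; [auto |].
apply (IH (PS_decr_1 c)); [now apply subexponential_decr_1 |].
intros r Hr.
assert (E := PSeries_decr_1 c r).
rewrite (H r Hr), (H0 c Hc H) in E.
assert (ex_pseries c r).
{ apply CV_radius_inside, subexponential_CV_radius; [easy |]. rewrite Rabs_pos_eq; lra. }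
specialize (E H1). nra.
Qed.

(** * Series in powers of q *)


(** [C_derive] is a limit along the horizontal line through z, so two real derivatives compute it
    without any complex differentiability. *)
Lemma C_derive_horizontal (f : C -> C) (z : C) (l1 l2 : R) :
  is_derive (fun x => Re (f (x, Im z))) (Re z) l1 ->
  is_derive (fun x => Im (f (x, Im z))) (Re z) l2 ->
  C_derive f z = (l1, l2).
Proof.
intros H1 H2.
assert (Hlim : forall (g : R -> R) (F : R -> R) x l, is_derive g x l ->
   (forall y, y <> x -> F y = (g y - g x) / (y - x)) -> real (Lim F x) = l).
{ intros g F x l Hd HF. erewrite is_lim_unique with (l := Finite l); [easy |].
  apply is_lim_spec. intros eps. apply is_derive_Reals in Hd.
  destruct (Hd eps (cond_pos eps)) as [d Hd']. exists d. intros y Hy Hne.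
  rewrite HF by easy.
  replace y with (x + (y - x)) at 1 by ring. apply Hd'; [lra | apply Hy]. }
unfold C_derive, C_lim. destruct z as [x y]. simpl in *.
f_equal.
- apply Hlim with (1 := H1). intros t Ht. unfold Re, Im; simpl.
  assert (t - x <> 0) by lra. replace (t + - x) with (t - x) by ring.
  replace (y + - y) with 0 by ring. field; nra.
- apply Hlim with (1 := H2). intros t Ht. unfold Re, Im; simpl.
  assert (t - x <> 0) by lra. replace (t + - x) with (t - x) by ring.
  replace (y + - y) with 0 by ring. field; nra.
Qed.

(** The horizontal line through a point of the half-plane stays inside it, so values elsewhere do
    not enter the limit. *)
Lemma qD_ext_H (f g : C -> C) :
  (forall tau, upper_half_plane tau -> f tau = g tau) ->
  forall tau, upper_half_plane tau -> qD f tau = qD g tau.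
Proof.
intros H tau Htau. unfold qD. f_equal. unfold C_derive, C_lim.
destruct tau as [x y]. unfold upper_half_plane in *; simpl in *.
f_equal; f_equal; apply Lim_ext; intros t; rewrite !H by easy; reflexivity.
Qed.

Lemma qDn_ext_H (f g : C -> C) (k : nat) :
  (forall tau, upper_half_plane tau -> f tau = g tau) ->
  forall tau, upper_half_plane tau -> qDn k f tau = qDn k g tau.
Proof.
intros H. induction k as [| k IH]; [exact H |]. exact (qD_ext_H _ _ IH).
Qed.

Lemma qpow_eq (r x y : R) :
  qpow r (x, y) = (exp (- (2 * PI * r * y)) * cos (2 * PI * r * x),
                   exp (- (2 * PI * r * y)) * sin (2 * PI * r * x)).
Proof.
unfold qpow, Cexp, Re, Im. simpl. f_equal; f_equal; f_equal; ring.
Qed.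

Lemma qpow_plus (r r' : R) (tau : C) : qpow (r + r') tau = Cmult (qpow r tau) (qpow r' tau).
Proof.
destruct tau as [x y]. rewrite !qpow_eq. unfold Cmult; simpl.
replace (2 * PI * (r + r') * x) with (2 * PI * r * x + 2 * PI * r' * x) by ring.
replace (- (2 * PI * (r + r') * y)) with (- (2 * PI * r * y) + - (2 * PI * r' * y)) by ring.
rewrite cos_plus, sin_plus, exp_plus. f_equal; ring.
Qed.

Lemma qpow_0 (tau : C) : qpow 0 tau = 1%C.
Proof.
destruct tau as [x y]. rewrite qpow_eq, !Rmult_0_r, !Rmult_0_l, Ropp_0, exp_0, cos_0, sin_0.
unfold RtoC. f_equal; ring.
Qed.

Lemma nome_pow (n : nat) (tau : C) : (nome tau ^ n)%C = qpow (INR n) tau.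
Proof.
induction n as [| n IH]; [now rewrite qpow_0 |].
rewrite S_INR, Rplus_comm, qpow_plus, <- IH. reflexivity.
Qed.

Definition qseries (c : nat -> R) (beta : R) (tau : C) : C :=
  CSeries (fun n => RtoC (c n) * qpow (beta + INR n) tau)%C.

(** The imaginary part is written with a cosine of phase -PI/2 and the real part with phase 0, so
    that [is_derive_trig_series] applies to both. *)
Lemma qseries_eq (c : nat -> R) (beta x y : R) :
  qseries c beta (x, y) =
  (Series (fun n => c n * exp (- (2 * PI * (beta + INR n) * y))
      * cos (2 * PI * (beta + INR n) * x + 0)),
   Series (fun n => c n * exp (- (2 * PI * (beta + INR n) * y))
      * cos (2 * PI * (beta + INR n) * x + - (PI / 2)))).
Proof.
unfold qseries, CSeries. f_equal; apply Series_ext; intros n; rewrite qpow_eq; unfold Re, Im; simpl.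
- rewrite Rplus_0_r. ring.
- rewrite cos_plus, cos_neg, sin_neg, cos_PI2, sin_PI2. ring.
Qed.

Lemma exp_split (beta y : R) (n : nat) :
  exp (- (2 * PI * (beta + INR n) * y)) = exp (- (2 * PI * beta * y)) * exp (- (2 * PI * y)) ^ n.
Proof.
replace (- (2 * PI * (beta + INR n) * y)) with (- (2 * PI * beta * y) + INR n * - (2 * PI * y)) by ring.
rewrite exp_plus. f_equal.
induction n as [| n IH]; [now rewrite Rmult_0_l, exp_0 |].
rewrite S_INR, Rmult_plus_distr_r, exp_plus, IH, Rmult_1_l. simpl. ring.
Qed.

Lemma exp_nome_lt_1 (y : R) : 0 < y -> 0 < exp (- (2 * PI * y)) < 1.
Proof.
intros Hy. split; [apply exp_pos |]. rewrite <- exp_0. apply exp_increasing.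
pose proof PI_RGT_0. nra.
Qed.

(** The operator D read on the coefficients of q^(beta+n). *)
Definition qshift (beta : R) (c : nat -> R) (n : nat) : R := (beta + INR n) * c n.

Lemma subexponential_qshift (beta : R) (c : nat -> R) :
  subexponential c -> subexponential (qshift beta c).
Proof.
intros Hc. apply subexponential_ext with (fun n => beta * c n + INR n * c n).
- intros n. unfold qshift. ring.
- apply subexponential_plus; [now apply subexponential_scal | now apply subexponential_mul_INR].
Qed.

(** The factor [k] takes up the powers of 2 PI that come with the frequencies. *)
Lemma ex_series_qseries (c : nat -> R) (beta y k : R) :
  subexponential c -> 0 < y ->
  ex_series (fun n => Rabs (k * (c n * exp (- (2 * PI * (beta + INR n) * y))))).
Proof.
intros Hc Hy.
apply ex_series_ext with (fun n => Rabs (k * exp (- (2 * PI * beta * y)) *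
   c n * exp (- (2 * PI * y)) ^ n)).
- intros n. rewrite exp_split. f_equal. ring.
- apply (subexponential_ex_series (fun n => k * exp (- (2 * PI * beta * y)) * c n));
  [now apply subexponential_scal | now apply exp_nome_lt_1].
Qed.

Lemma qD_qseries (c : nat -> R) (beta : R) (tau : C) :
  subexponential c -> upper_half_plane tau ->
  qD (qseries c beta) tau = qseries (qshift beta c) beta tau.
Proof.
intros Hc Htau. destruct tau as [x y]. unfold upper_half_plane in Htau; simpl in Htau.
pose proof PI_RGT_0 as Hpi.
set (b := fun n => c n * exp (- (2 * PI * (beta + INR n) * y))).
set (lam := fun n => 2 * PI * (beta + INR n)).
assert (D : forall phi, is_derive
  (fun x => Series (fun n => b n * cos (lam n * x + phi))) x
  (Series (fun n => - (lam n * b n * sin (lam n * x + phi))))).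
{ intros phi. apply (is_derive_trig_series b lam (fun _ => phi)).
  - apply ex_series_ext with (2 := ex_series_qseries c beta y 1 Hc Htau).
    intros n. unfold b. f_equal. ring.
  - apply ex_series_ext with (2 := ex_series_qseries _ beta y (2 * PI)
       (subexponential_qshift beta c Hc) Htau).
    intros n. unfold b, lam, qshift. f_equal. ring.
  - apply ex_series_ext with (2 := ex_series_qseries _ beta y (2 * PI * (2 * PI))
       (subexponential_qshift beta _ (subexponential_qshift beta c Hc)) Htau).
    intros n. unfold b, lam, qshift. f_equal. ring. }
unfold qD.
rewrite (C_derive_horizontal (qseries c beta) (x, y) _ _
  (is_derive_ext _ (fun t => Re (qseries c beta (t, y))) _ _
     (fun t => eq_sym (f_equal Re (qseries_eq c beta t y))) (D 0))
  (is_derive_ext _ (fun t => Im (qseries c beta (t, y))) _ _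
     (fun t => eq_sym (f_equal Im (qseries_eq c beta t y))) (D (- (PI / 2))))).
rewrite qseries_eq.
set (S1 := Series (fun n => - (lam n * b n * sin (lam n * x + 0)))).
set (S2 := Series (fun n => - (lam n * b n * sin (lam n * x + - (PI / 2))))).
(* Division by 2 PI i swaps the two parts up to sign; the phase -PI/2 then turns the differentiated
   series back into the original form. *)
transitivity ((/ (2 * PI) * S2, - / (2 * PI) * S1) : C).
- unfold Cdiv, Cmult, Cinv, Ci, RtoC; simpl. f_equal; field; lra.
- unfold S1, S2. rewrite <- !Series_scal_l. f_equal; apply Series_ext; intros n;
  unfold b, lam, qshift.
  + rewrite sin_plus, sin_neg, cos_neg, sin_PI2, cos_PI2, Rplus_0_r. field. lra.
  + rewrite cos_plus, sin_neg, cos_neg, sin_PI2, cos_PI2, Rplus_0_r. field. lra.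
Qed.

Lemma qDn_qseries (c : nat -> R) (beta : R) (k : nat) :
  subexponential c ->
  subexponential (Nat.iter k (qshift beta) c) /\
  forall tau, upper_half_plane tau ->
    qDn k (qseries c beta) tau = qseries (Nat.iter k (qshift beta) c) beta tau.
Proof.
intros Hc. induction k as [| k [IH1 IH2]]; [easy |]. split.
- now apply subexponential_qshift.
- intros tau Htau. transitivity (qD (qseries (Nat.iter k (qshift beta) c) beta) tau).
  + exact (qD_ext_H _ _ IH2 tau Htau).
  + now apply qD_qseries.
Qed.

(** On the imaginary axis q = exp(-2 PI y) is real, so a q-series becomes a real power series times
    q^beta. *)
Lemma qseries_vertical (c : nat -> R) (beta y : R) :
  qseries c beta (0, y) =
  RtoC (exp (- (2 * PI * beta * y)) * PSeries c (exp (- (2 * PI * y)))).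
Proof.
unfold PSeries. rewrite <- Series_scal_l, qseries_eq. unfold RtoC.
f_equal.
- apply Series_ext. intros n. rewrite exp_split, Rmult_0_r, Rplus_0_r, cos_0. ring.
- transitivity (Series (fun _ => 0 * 0)); [| rewrite Series_scal_l; ring].
  apply Series_ext. intros n.
  rewrite (Rmult_0_r (2 * PI * (beta + INR n))), Rplus_0_l, cos_neg, cos_PI2. ring.
Qed.

(** * Eisenstein series and functions of CFT type *)


Lemma subexponential_of_ex_series (c : nat -> R) :
  (forall r, 0 < r < 1 -> ex_series (fun n => c n * r ^ n)) -> subexponential c.
Proof.
intros H r Hr.
destruct (filterlim_bounded (fun n => c n * r ^ n)) as [M HM].
- exists 0. exact (ex_series_lim_0 _ (H r Hr)).
- exists M. intros n. specialize (HM n). unfold norm in HM; simpl in HM; unfold abs in HM; simpl in HM.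
  rewrite Rabs_mult, (Rabs_pos_eq (r ^ n)) in HM; [easy | apply pow_le; lra].
Qed.

Lemma ex_pseries_iff_ex_series (c : nat -> R) (r : R) :
  ex_pseries c r <-> ex_series (fun n => c n * r ^ n).
Proof.
unfold ex_pseries, is_pseries.
assert (E : forall n, scal (pow_n r n) (c n) = c n * r ^ n).
{ intros n. rewrite pow_n_pow. apply Rmult_comm. }
split; intros [l Hl]; exists l; revert Hl; apply is_series_ext; intros n; now rewrite E.
Qed.

Lemma subexponential_ex_pseries (c : nat -> R) (r : R) :
  subexponential c -> 0 < r < 1 -> ex_pseries c r.
Proof.
intros Hc Hr. apply CV_radius_inside, subexponential_CV_radius; [easy |]. rewrite Rabs_pos_eq; lra.
Qed.

Lemma subexponential_mult (a b : nat -> R) :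
  subexponential a -> subexponential b -> subexponential (PS_mult a b).
Proof.
intros Ha Hb. apply subexponential_of_ex_series. intros r Hr.
apply ex_pseries_iff_ex_series.
apply ex_pseries_mult; apply subexponential_CV_radius; auto; rewrite Rabs_pos_eq; lra.
Qed.

Lemma PSeries_mult_subexponential (a b : nat -> R) (r : R) :
  subexponential a -> subexponential b -> 0 < r < 1 ->
  PSeries (PS_mult a b) r = PSeries a r * PSeries b r.
Proof.
intros Ha Hb Hr.
apply PSeries_mult; apply subexponential_CV_radius; auto; rewrite Rabs_pos_eq; lra.
Qed.

(** The shape k a + b is the one in which the coefficients of the differential equation are nested
    below, so rewriting with this lemma unfolds them completely. *)
Lemma PSeries_lin_subexponential (k : R) (a b : nat -> R) (r : R) :
  subexponential a -> subexponential b -> 0 < r < 1 ->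
  PSeries (fun n => k * a n + b n) r = k * PSeries a r + PSeries b r.
Proof.
intros Ha Hb Hr.
rewrite <- PSeries_scal.
rewrite <- (PSeries_plus (PS_scal k a) b); [reflexivity | |].
- apply subexponential_ex_pseries; [now apply subexponential_scal | easy].
- now apply subexponential_ex_pseries.
Qed.

(** A crude count suffices: at most n divisors, each at most n. *)
Lemma divisor_sigma_bound (k n : nat) :
  (0 <= divisor_sigma k n <= Z.of_nat n * Z.of_nat n ^ Z.of_nat k)%Z.
Proof.
unfold divisor_sigma, divisors.
assert (H : forall l, (forall d, In d l -> (d <= n)%nat) ->
 (0 <= fold_right Z.add 0 (map (fun d => Z.of_nat d ^ Z.of_nat k) l) <=
   Z.of_nat (length l) * Z.of_nat n ^ Z.of_nat k)%Z).
{ induction l as [| d l IH]; intros Hl; [simpl; lia |].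
  assert (IH' := IH (fun d' Hd => Hl d' (or_intror Hd))).
  assert (Hd := Hl d (or_introl eq_refl)).
  simpl fold_right. simpl length. rewrite Nat2Z.inj_succ.
  assert (0 <= Z.of_nat d ^ Z.of_nat k <= Z.of_nat n ^ Z.of_nat k)%Z.
  { split; [apply Z.pow_nonneg; lia | apply Z.pow_le_mono_l; lia]. }
  lia. }
assert (L := filter_length_le (fun d => Nat.eqb (Nat.modulo n d) 0) (seq 1 n)).
rewrite length_seq in L.
specialize (H (filter (fun d => Nat.eqb (Nat.modulo n d) 0) (seq 1 n))).
destruct H as [H1 H2].
- intros d Hd. apply filter_In in Hd. destruct Hd as [Hd _]. apply in_seq in Hd. lia.
- split; [easy |]. apply Z.le_trans with (1 := H2).
  apply Z.mul_le_mono_nonneg_r; [apply Z.pow_nonneg; lia | lia].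
Qed.

(** Integer valued, so that both the analytic argument and the exact rational computation can use
    it. *)
Definition eisenstein_coef (k : nat) (c : Z) (n : nat) : Z :=
  match n with O => 1%Z | S _ => (c * divisor_sigma (k - 1) n)%Z end.

Lemma subexponential_INR_pow (k : nat) : subexponential (fun n => INR n ^ k).
Proof.
induction k as [| k IH]; [exact (subexponential_const 1) |].
exact (subexponential_mul_INR _ IH).
Qed.

Lemma subexponential_eisenstein_coef (k : nat) (c : Z) :
  subexponential (fun n => IZR (eisenstein_coef k c n)).
Proof.
apply subexponential_le with (fun n => 1 + Rabs (IZR c) * INR n ^ S (k - 1)).
- intros n. assert (Hp : 0 <= Rabs (IZR c) * INR n ^ S (k - 1)).
  { apply Rmult_le_pos; [apply Rabs_pos | apply pow_le, pos_INR]. }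
  rewrite (Rabs_pos_eq (1 + _)) by lra.
  destruct n as [| n]; [simpl eisenstein_coef; rewrite Rabs_R1; lra |].
  unfold eisenstein_coef. rewrite mult_IZR, Rabs_mult.
  apply Rle_trans with (Rabs (IZR c) * INR (S n) ^ S (k - 1)); [| lra].
  apply Rmult_le_compat_l; [apply Rabs_pos |].
  destruct (divisor_sigma_bound (k - 1) (S n)) as [H1 H2].
  rewrite Rabs_pos_eq by now apply IZR_le.
  apply Rle_trans with (1 := IZR_le _ _ H2). right.
  rewrite mult_IZR, <- pow_IZR, <- INR_IZR_INZ. reflexivity.
- apply subexponential_plus; [exact (subexponential_const 1) |].
  apply subexponential_scal, subexponential_INR_pow.
Qed.

Lemma ex_series_Re_Im_qseries (c : nat -> R) (beta : R) (tau : C) :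
  subexponential c -> upper_half_plane tau ->
  ex_series (fun n => Re (RtoC (c n) * qpow (beta + INR n) tau)%C) /\
  ex_series (fun n => Im (RtoC (c n) * qpow (beta + INR n) tau)%C).
Proof.
intros Hc Htau. destruct tau as [x y]. unfold upper_half_plane in Htau; simpl in Htau.
assert (H := ex_series_qseries c beta y 1 Hc Htau).
split; refine (ex_series_le (V := R_CompleteNormedModule) _ _ _ H); intros n;
  rewrite qpow_eq; unfold norm; simpl; unfold abs, Re, Im; simpl; rewrite !Rmult_0_l;
  [rewrite Rminus_0_r | rewrite Rplus_0_r]; rewrite <- Rmult_assoc, Rmult_1_l, Rabs_mult;
  rewrite <- (Rmult_1_r (Rabs (c n * exp _))) at 2;
  (apply Rmult_le_compat_l; [apply Rabs_pos | apply Rabs_le]).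
- pose proof (COS_bound (2 * PI * (beta + INR n) * x)). lra.
- pose proof (SIN_bound (2 * PI * (beta + INR n) * x)). lra.
Qed.

Lemma eisenstein_series_eq (k : nat) (c : Z) (tau : C) :
  upper_half_plane tau ->
  eisenstein_series k c tau = qseries (fun n => IZR (eisenstein_coef k c n)) 0 tau.
Proof.
intros Htau.
destruct (ex_series_Re_Im_qseries _ 0 tau (subexponential_eisenstein_coef k c) Htau) as [H1 H2].
unfold qseries, CSeries.
rewrite (Series_incr_1 _ H1), (Series_incr_1 _ H2).
unfold eisenstein_series, CSeries.
rewrite Rplus_0_l, qpow_0.
set (u := fun n => (RtoC (IZR (divisor_sigma (k - 1) (S n))) * nome tau ^ S n)%C).
rewrite (Series_ext (fun n => Re (RtoC (IZR (eisenstein_coef k c (S n))) * qpow (0 + INR (S n)) tau)%C)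
  (fun n => IZR c * Re (u n))).
rewrite (Series_ext (fun n => Im (RtoC (IZR (eisenstein_coef k c (S n))) * qpow (0 + INR (S n)) tau)%C)
  (fun n => IZR c * Im (u n))).
- rewrite !Series_scal_l. unfold Cmult, Cplus, RtoC, Re, Im; simpl. f_equal; ring.
- intros n. unfold u. rewrite Rplus_0_l, nome_pow. unfold eisenstein_coef. rewrite mult_IZR.
  unfold Re, Im; simpl. ring.
- intros n. unfold u. rewrite Rplus_0_l, nome_pow. unfold eisenstein_coef. rewrite mult_IZR.
  unfold Re, Im; simpl. ring.
Qed.

Lemma is_series_Re_Im (u : nat -> C) (l : C) :
  is_series (K := C_AbsRing) (V := C_NormedModule) u l ->
  is_series (fun n => Re (u n)) (Re l) /\ is_series (fun n => Im (u n)) (Im l).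
Proof.
intros H. unfold is_series in *.
assert (E : forall n, sum_n (fun n => Re (u n)) n = Re (sum_n (G := C_AbelianGroup) u n) /\
   sum_n (fun n => Im (u n)) n = Im (sum_n (G := C_AbelianGroup) u n)).
{ induction n as [| n [IH1 IH2]]; [now rewrite !sum_O |].
  rewrite !sum_Sn, IH1, IH2. easy. }
split.
- apply (filterlim_ext (fun n => Re (sum_n (G := C_AbelianGroup) u n)));
    [intros n; symmetry; apply E |].
  apply filterlim_comp with (1 := H). intros P [eps HP]. exists eps. intros y Hy. apply HP, Hy.
- apply (filterlim_ext (fun n => Im (sum_n (G := C_AbelianGroup) u n)));
    [intros n; symmetry; apply E |].
  apply filterlim_comp with (1 := H). intros P [eps HP]. exists eps. intros y Hy. apply HP, Hy.
Qed.

(** [CFT_type] leaves [a 0] free; the leading coefficient is 1 instead. *)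
Definition monic_coef (a : nat -> nat) (n : nat) : Z :=
  match n with O => 1%Z | S _ => Z.of_nat (a n) end.

Lemma CFT_type_qseries (f : C -> C) (alpha : R) (a : nat -> nat) :
  (forall tau : C, upper_half_plane tau ->
      exists l : C,
        is_series (K := C_AbsRing) (V := C_NormedModule)
          (fun n => RtoC (INR (a (S n))) * nome tau ^ S n)%C l /\
        f tau = (qpow alpha tau * (1 + l))%C) ->
  subexponential (fun n => IZR (monic_coef a n)) /\
  forall tau, upper_half_plane tau ->
    f tau = qseries (fun n => IZR (monic_coef a n)) alpha tau.
Proof.
intros H.
assert (Hs : subexponential (fun n => IZR (monic_coef a n))).
{ apply subexponential_of_ex_series. intros r Hr.
  apply ex_series_incr_1.
  (* The point iy has q = r, so convergence on the half-plane gives convergence for every r in (0,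
     1). *)
  set (y := - ln r / (2 * PI)). pose proof PI_RGT_0.
  assert (Hln : ln r < 0) by (rewrite <- ln_1; apply ln_increasing; lra).
  assert (Hy : 0 < y) by (apply Rdiv_lt_0_compat; lra).
  destruct (H (0, y) Hy) as [l [Hl _]]. apply is_series_Re_Im in Hl. destruct Hl as [Hl _].
  exists (Re l). revert Hl. apply is_series_ext. intros n.
  assert (Er : r = exp (- (2 * PI * y))).
  { unfold y. replace (- (2 * PI * (- ln r / (2 * PI)))) with (ln r) by (field; lra).
    rewrite exp_ln; lra. }
  rewrite nome_pow, <- (Rplus_0_l (INR (S n))), qpow_eq, exp_split, <- Er.
  unfold Re, monic_coef. rewrite <- INR_IZR_INZ.
  set (p := r ^ S n). simpl fst. rewrite !Rmult_0_r, !Rmult_0_l, Ropp_0, exp_0, cos_0. 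
  match goal with |- ?x = ?y => change (@eq R x y) end. ring. }
split; [easy |].
intros tau Htau. destruct (H tau Htau) as [l [Hl Ef]]. rewrite Ef.
destruct (ex_series_Re_Im_qseries _ alpha tau Hs Htau) as [H1 H2].
unfold qseries, CSeries.
rewrite (Series_incr_1 _ H1), (Series_incr_1 _ H2).
apply (is_series_scal (qpow alpha tau)) in Hl.
apply (is_series_ext _ (fun n => RtoC (IZR (monic_coef a (S n))) * qpow (alpha + INR (S n)) tau)%C)
  in Hl.
- apply is_series_Re_Im in Hl. destruct Hl as [Hl1 Hl2].
  rewrite (is_series_unique _ _ Hl1), (is_series_unique _ _ Hl2).
  simpl monic_coef. rewrite Rplus_0_r. unfold scal; simpl. unfold mult; simpl.
  unfold Cmult, Cplus, RtoC, Re, Im; simpl. f_equal; ring.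
- intros n.
  change (qpow alpha tau * (RtoC (INR (a (S n))) * nome tau ^ S n) =
    RtoC (IZR (Z.of_nat (a (S n)))) * qpow (alpha + INR (S n)) tau)%C.
  rewrite qpow_plus, nome_pow, <- INR_IZR_INZ. ring.
Qed.

(** * The recurrence *)


Definition qseries_coef (k : nat) (alpha : R) (a : nat -> R) : nat -> R :=
  Nat.iter k (qshift alpha) a.

(** Coefficients of D^j E_k, with [c] the factor in front of the divisor sums. *)
Definition eis (j : nat) (k : nat) (c : Z) : nat -> R :=
  qseries_coef j 0 (fun n => IZR (eisenstein_coef k c n)).

(* The left-hand side of (flat_s) is F0 + alpha1 F1 + alpha2 F2 + alpha3 F3 with the F_i free of s;
   [flat_coef0], ..., [flat_coef3] are the coefficients of q^(-alpha) F_i. *)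
Definition flat_coef0 (alpha : R) (a : nat -> R) (n : nat) : R :=
  -1 * PS_mult (qseries_coef 3 alpha a) (eis 0 2 (-24)) n
  + (3 * PS_mult (qseries_coef 2 alpha a) (eis 1 2 (-24)) n
  + (-1 * PS_mult (qseries_coef 1 alpha a) (eis 2 2 (-24)) n
  + qseries_coef 4 alpha a n)).

Definition flat_coef1 (alpha : R) (a : nat -> R) (n : nat) : R :=
  -1 / 2 * PS_mult (qseries_coef 1 alpha a) (eis 1 4 240) n
  + PS_mult (qseries_coef 2 alpha a) (eis 0 4 240) n.

Definition flat_coef2 (alpha : R) (a : nat -> R) : nat -> R :=
  PS_mult (qseries_coef 1 alpha a) (eis 0 6 (-504)).

Definition flat_coef3 (alpha : R) (a : nat -> R) : nat -> R :=
  PS_mult (qseries_coef 0 alpha a) (eis 0 8 480).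

Lemma Cmult_integral (z w : C) : (z * w = 0)%C -> z = 0%C \/ w = 0%C.
Proof.
intros H. destruct (Ceq_dec z 0) as [E | E]; [now left | right].
rewrite <- (Cmult_1_l w), <- (Cinv_l z E), <- Cmult_assoc, H. ring.
Qed.

Lemma flat_recurrence (s : C) (f : C -> C) (alpha : R) (a : nat -> R) :
  flat_solution s f -> subexponential a ->
  (forall tau, upper_half_plane tau -> f tau = qseries a alpha tau) ->
  forall n, (RtoC (flat_coef0 alpha a n) + alpha1 s * RtoC (flat_coef1 alpha a n)
     + alpha2 s * RtoC (flat_coef2 alpha a n) + alpha3 s * RtoC (flat_coef3 alpha a n) = 0)%C.
Proof.
intros [_ Hflat] Ha Hf n.
assert (Sd : forall k, subexponential (qseries_coef k alpha a)).
{ intros k. now apply qDn_qseries. }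
assert (Se : forall j k c, subexponential (eis j k c)).
{ intros j k c. apply qDn_qseries, subexponential_eisenstein_coef. }
assert (S0 : subexponential (flat_coef0 alpha a)).
{ unfold flat_coef0. repeat apply subexponential_plus; try apply subexponential_scal;
  try apply subexponential_mult; auto. }
assert (S1 : subexponential (flat_coef1 alpha a)).
{ unfold flat_coef1. repeat apply subexponential_plus; try apply subexponential_scal;
  try apply subexponential_mult; auto. }
assert (S2 : subexponential (flat_coef2 alpha a)) by now apply subexponential_mult.
assert (S3 : subexponential (flat_coef3 alpha a)) by now apply subexponential_mult.
assert (Hq : forall r, 0 < r < 1 ->
  (RtoC (PSeries (flat_coef0 alpha a) r) + alpha1 s * RtoC (PSeries (flat_coef1 alpha a) r)
     + alpha2 s * RtoC (PSeries (flat_coef2 alpha a) r)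
     + alpha3 s * RtoC (PSeries (flat_coef3 alpha a) r) = 0)%C).
{ intros r Hr.
  set (y := - ln r / (2 * PI)). pose proof PI_RGT_0.
  assert (Hln : ln r < 0) by (rewrite <- ln_1; apply ln_increasing; lra).
  assert (Hy : upper_half_plane (0, y)) by (apply Rdiv_lt_0_compat; lra).
  assert (Er : exp (- (2 * PI * y)) = r).
  { unfold y. replace (- (2 * PI * (- ln r / (2 * PI)))) with (ln r) by (field; lra).
    rewrite exp_ln; lra. }
  (* w is the value of q^alpha at iy. It is common to all terms and nonzero, so it can be
     cancelled. *)
  set (w := exp (- (2 * PI * alpha * y))).
  assert (Hw : RtoC w <> 0%C).
  { intros E. apply RtoC_inj in E. pose proof (exp_pos (- (2 * PI * alpha * y))).
    unfold w in E. lra. }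
  assert (Fd : forall k, qDn k f (0, y) = RtoC (w * PSeries (qseries_coef k alpha a) r)).
  { intros k. rewrite (qDn_ext_H _ _ k Hf _ Hy).
    rewrite (proj2 (qDn_qseries a alpha k Ha) _ Hy), qseries_vertical, Er. reflexivity. }
  assert (Fe : forall j k c, qDn j (eisenstein_series k c) (0, y) = RtoC (PSeries (eis j k c) r)).
  { intros j k c. rewrite (qDn_ext_H _ _ j (eisenstein_series_eq k c) _ Hy).
    rewrite (proj2 (qDn_qseries _ 0 j (subexponential_eisenstein_coef k c)) _ Hy),
      qseries_vertical, Er.
    replace (- (2 * PI * 0 * y)) with 0 by ring. now rewrite exp_0, Rmult_1_l. }
  specialize (Hflat _ Hy). unfold flat_lhs, E2, E4, E6, E8 in Hflat.
  change (qD (eisenstein_series 2 (-24)) (0, y)) with (qDn 1 (eisenstein_series 2 (-24)) (0, y))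
    in Hflat.
  change (qD (eisenstein_series 4 240) (0, y)) with (qDn 1 (eisenstein_series 4 240) (0, y))
    in Hflat.
  change (qD f (0, y)) with (qDn 1 f (0, y)) in Hflat.
  change (f (0, y)) with (qDn 0 f (0, y)) in Hflat.
  change (eisenstein_series 2 (-24) (0, y)) with (qDn 0 (eisenstein_series 2 (-24)) (0, y)) in Hflat.
  change (eisenstein_series 4 240 (0, y)) with (qDn 0 (eisenstein_series 4 240) (0, y)) in Hflat.
  change (eisenstein_series 6 (-504) (0, y)) with (qDn 0 (eisenstein_series 6 (-504)) (0, y)) in Hflat.
  change (eisenstein_series 8 480 (0, y)) with (qDn 0 (eisenstein_series 8 480) (0, y)) in Hflat.
  rewrite !Fd, !Fe in Hflat.
  assert (V0 : PSeries (flat_coef0 alpha a) r =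
     -1 * (PSeries (qseries_coef 3 alpha a) r * PSeries (eis 0 2 (-24)) r)
     + (3 * (PSeries (qseries_coef 2 alpha a) r * PSeries (eis 1 2 (-24)) r)
     + (-1 * (PSeries (qseries_coef 1 alpha a) r * PSeries (eis 2 2 (-24)) r)
     + PSeries (qseries_coef 4 alpha a) r))).
  { unfold flat_coef0.
    rewrite !PSeries_lin_subexponential, !PSeries_mult_subexponential; auto;
    repeat apply subexponential_plus; try apply subexponential_scal;
    try apply subexponential_mult; auto. }
  assert (V1 : PSeries (flat_coef1 alpha a) r =
     -1 / 2 * (PSeries (qseries_coef 1 alpha a) r * PSeries (eis 1 4 240) r)
     + PSeries (qseries_coef 2 alpha a) r * PSeries (eis 0 4 240) r).
  { unfold flat_coef1.
    rewrite !PSeries_lin_subexponential, !PSeries_mult_subexponential; auto;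
    try apply subexponential_mult; auto. }
  assert (V2 : PSeries (flat_coef2 alpha a) r =
     PSeries (qseries_coef 1 alpha a) r * PSeries (eis 0 6 (-504)) r).
  { now apply PSeries_mult_subexponential. }
  assert (V3 : PSeries (flat_coef3 alpha a) r =
     PSeries (qseries_coef 0 alpha a) r * PSeries (eis 0 8 480) r).
  { now apply PSeries_mult_subexponential. }
  rewrite V0, V1, V2, V3.
  match goal with |- ?X = _ => destruct (Cmult_integral (RtoC w) X) as [E | E]; [| easy | exact E] end.
  rewrite <- Hflat.
  unfold Rdiv. repeat rewrite ?RtoC_plus, ?RtoC_mult. rewrite RtoC_inv by lra.
  replace (RtoC (-1)) with (Copp 1) by (unfold Copp, RtoC; simpl; f_equal; ring).
  unfold Cdiv. ring. }
(* Here s is still complex, while [PSeries_eq_0] is real. The identity is therefore split into real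
   and imaginary parts, with weights (1, Re alpha_i) and (0, Im alpha_i). *)
assert (Hu : forall u0 u1 u2 u3 : R,
  (forall r, 0 < r < 1 -> u3 * PSeries (flat_coef3 alpha a) r + (u2 * PSeries (flat_coef2 alpha a) r
     + (u1 * PSeries (flat_coef1 alpha a) r + u0 * PSeries (flat_coef0 alpha a) r)) = 0) ->
  u3 * flat_coef3 alpha a n + (u2 * flat_coef2 alpha a n
     + (u1 * flat_coef1 alpha a n + u0 * flat_coef0 alpha a n)) = 0).
{ intros u0 u1 u2 u3 H.
  apply (PSeries_eq_0 (fun n => u3 * flat_coef3 alpha a n + (u2 * flat_coef2 alpha a n
     + (u1 * flat_coef1 alpha a n + u0 * flat_coef0 alpha a n)))).
  - repeat apply subexponential_plus; now apply subexponential_scal.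
  - intros r Hr. rewrite <- (H r Hr), <- (PSeries_scal u0).
    rewrite !PSeries_lin_subexponential; auto;
    repeat apply subexponential_plus; now apply subexponential_scal. }
assert (HR := Hu 1 (Re (alpha1 s)) (Re (alpha2 s)) (Re (alpha3 s))).
assert (HI := Hu 0 (Im (alpha1 s)) (Im (alpha2 s)) (Im (alpha3 s))).
destruct (alpha1 s) as [x1 y1], (alpha2 s) as [x2 y2], (alpha3 s) as [x3 y3].
unfold Re, Im in HR, HI; cbn [fst snd] in HR, HI.
unfold Cplus, Cmult, RtoC; cbn [fst snd]. f_equal.
- refine (eq_trans _ (HR _)); [ring |]. intros r Hr. specialize (Hq r Hr). apply (f_equal fst) in Hq.
  unfold Cplus, Cmult, RtoC in Hq; cbn [fst snd] in Hq.
  refine (eq_trans _ Hq). ring.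
- refine (eq_trans _ (HI _)); [ring |]. intros r Hr. specialize (Hq r Hr). apply (f_equal snd) in Hq.
  unfold Cplus, Cmult, RtoC in Hq; cbn [fst snd] in Hq.
  refine (eq_trans _ Hq). ring.
Qed.

(** * Exact rational computation of the coefficients *)


(** What a term q^x of f contributes to the coefficient of q^(x+j), apart from D^4 f. The factors j
    come from derivatives of Eisenstein series, the powers of x from derivatives of f. *)
Definition flat_kernel (A1 A2 A3 : R) (j : nat) (x : R) : R :=
  let e := fun k c => IZR (eisenstein_coef k c j) in
  - e 2%nat (-24)%Z * (x * x * x)
  + (3 * INR j * e 2%nat (-24)%Z + A1 * e 4%nat 240%Z) * (x * x)
  - (INR j * INR j * e 2%nat (-24)%Z + A1 / 2 * INR j * e 4%nat 240%Z
     - A2 * e 6%nat (-504)%Z) * x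
  + A3 * e 8%nat 480%Z.

Lemma flat_coef_sum (A1 A2 A3 alpha : R) (a : nat -> R) (n : nat) :
  flat_coef0 alpha a n + A1 * flat_coef1 alpha a n + A2 * flat_coef2 alpha a n
    + A3 * flat_coef3 alpha a n =
  sum_f_R0 (fun i => flat_kernel A1 A2 A3 (n - i) (alpha + INR i) * a i) n
    + (alpha + INR n) ^ 4 * a n.
Proof.
unfold flat_coef0, flat_coef1, flat_coef2, flat_coef3, PS_mult.
assert (H : forall f1 f2 f3 f4 f5 f6 f7 g : nat -> R,
  (forall i, g i = -1 * f1 i + (3 * f2 i + -1 * f3 i) + A1 * (-1 / 2 * f4 i + f5 i)
     + A2 * f6 i + A3 * f7 i) ->
  forall m, sum_f_R0 g m = -1 * sum_f_R0 f1 m + (3 * sum_f_R0 f2 m + -1 * sum_f_R0 f3 m)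
     + A1 * (-1 / 2 * sum_f_R0 f4 m + sum_f_R0 f5 m) + A2 * sum_f_R0 f6 m + A3 * sum_f_R0 f7 m).
{ intros f1 f2 f3 f4 f5 f6 f7 g Hg. induction m as [| m IH]; simpl; rewrite ?IH, Hg; ring. }
rewrite (H (fun k => qseries_coef 3 alpha a k * eis 0 2 (-24) (n - k))
  (fun k => qseries_coef 2 alpha a k * eis 1 2 (-24) (n - k))
  (fun k => qseries_coef 1 alpha a k * eis 2 2 (-24) (n - k))
  (fun k => qseries_coef 1 alpha a k * eis 1 4 240 (n - k))
  (fun k => qseries_coef 2 alpha a k * eis 0 4 240 (n - k))
  (fun k => qseries_coef 1 alpha a k * eis 0 6 (-504) (n - k))
  (fun k => qseries_coef 0 alpha a k * eis 0 8 480 (n - k))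
  (fun i => flat_kernel A1 A2 A3 (n - i) (alpha + INR i) * a i)).
- change (qseries_coef 4 alpha a n) with
    ((alpha + INR n) * ((alpha + INR n) * ((alpha + INR n) * ((alpha + INR n) * a n)))). ring.
- intros i. unfold flat_kernel, eis, qseries_coef, Nat.iter, qshift. cbn [nat_rect]. field.
Qed.

Local Open Scope Q_scope.

Definition flat_kernelQ (A1 A2 A3 : Q) (j : nat) (x : Q) : Q :=
  let e := fun k c => inject_Z (eisenstein_coef k c j) in
  let J := inject_Z (Z.of_nat j) in
  - e 2%nat (-24)%Z * (x * x * x)
  + (inject_Z 3 * J * e 2%nat (-24)%Z + A1 * e 4%nat 240%Z) * (x * x)
  - (J * J * e 2%nat (-24)%Z + A1 * (1 # 2) * J * e 4%nat 240%Z
     - A2 * e 6%nat (-504)%Z) * x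
  + A3 * e 8%nat 480%Z.

Definition alpha1Q (s : Q) : Q :=
  (- (inject_Z 25) * (s * s) + inject_Z 120 * s + inject_Z 1332) * (1 # 7200).
Definition alpha2Q (s : Q) : Q :=
  let t := inject_Z 5 * s + inject_Z 6 in t * t * (1 # 14400).
Definition alpha3Q (s : Q) : Q :=
  let t := inject_Z 5 * s + inject_Z 6 in
  (s - inject_Z 18) * (s + inject_Z 6) * (t * t) * (1 # 8294400).

(** The list runs by decreasing index, so the length of the tail is the index of its head. [Qred]
    keeps the fractions small. *)
Fixpoint recurrence_sum (A1 A2 A3 alpha : Q) (n : nat) (l : list Z) : Q :=
  match l with
  | nil => 0
  | x :: l' =>
      Qred (Qred (flat_kernelQ A1 A2 A3 (n - length l') (alpha + inject_Z (Z.of_nat (length l'))))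
        * inject_Z x + recurrence_sum A1 A2 A3 alpha n l')
  end.

(** At x = alpha + n this is the factor of a_n in the n-th equation. *)
Definition indicial (A1 A2 A3 x : Q) : Q :=
  Qred (flat_kernelQ A1 A2 A3 0 x + x * x * (x * x)).

(* [l] lists the coefficients [a_(n-1), ..., a_0]; the answer [true] means that some a_m with
   n <= m < n + fuel cannot be a nonnegative integer. *)
Fixpoint refutes (A1 A2 A3 alpha : Q) (fuel n : nat) (l : list Z) : bool :=
  match fuel with
  | O => false
  | S fuel' =>
      let I := indicial A1 A2 A3 (alpha + inject_Z (Z.of_nat n)) in
      let t := recurrence_sum A1 A2 A3 alpha n l in
      if Qeq_bool I 0 then negb (Qeq_bool t 0)
      else
        let v := Qred (- t / I) in
        if (Pos.eqb (Qden v) 1 && Z.leb 0 (Qnum v))%bool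
        then refutes A1 A2 A3 alpha fuel' (S n) (Qnum v :: l)
        else true
  end.

Fixpoint prefix (a : nat -> Z) (n : nat) : list Z :=
  match n with O => nil | S m => a m :: prefix a m end.

Local Open Scope R_scope.

Lemma Q2R_inject_Z (z : Z) : Q2R (inject_Z z) = IZR z.
Proof. unfold Q2R; simpl. field. Qed.

Lemma Q2R_Qred (x : Q) : Q2R (Qred x) = Q2R x.
Proof. apply Qeq_eqR, Qred_correct. Qed.

Ltac q2r := rewrite ?Q2R_Qred, ?Q2R_plus, ?Q2R_minus, ?Q2R_mult, ?Q2R_opp, ?Q2R_inject_Z.

Lemma Q2R_flat_kernelQ (A1 A2 A3 : Q) (j : nat) (x : Q) :
  Q2R (flat_kernelQ A1 A2 A3 j x) = flat_kernel (Q2R A1) (Q2R A2) (Q2R A3) j (Q2R x).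
Proof.
unfold flat_kernelQ, flat_kernel. repeat (progress q2r).
rewrite <- INR_IZR_INZ. replace (Q2R (1 # 2)) with (/ 2) by (unfold Q2R; simpl; lra).
unfold Rdiv. ring.
Qed.

Lemma length_prefix (a : nat -> Z) (n : nat) : length (prefix a n) = n.
Proof. induction n; simpl; auto. Qed.

Lemma Q2R_recurrence_sum (A1 A2 A3 alpha : Q) (a : nat -> Z) (n m : nat) :
  Q2R (recurrence_sum A1 A2 A3 alpha n (prefix a (S m))) =
  sum_f_R0 (fun i => flat_kernel (Q2R A1) (Q2R A2) (Q2R A3) (n - i) (Q2R alpha + INR i)
    * IZR (a i)) m.
Proof.
induction m as [| m IH].
- cbn [prefix recurrence_sum length sum_f_R0]. repeat (progress q2r).
  rewrite Q2R_flat_kernelQ. repeat (progress q2r). rewrite <- INR_IZR_INZ.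
  rewrite RMicromega.Q2R_0, Rplus_0_r. reflexivity.
- change (prefix a (S (S m))) with (a (S m) :: prefix a (S m)).
  cbn [recurrence_sum]. rewrite length_prefix, tech5, <- IH. repeat (progress q2r).
  rewrite Q2R_flat_kernelQ. repeat (progress q2r). rewrite <- INR_IZR_INZ. ring.
Qed.

(** Each value that the search appends is forced by the recurrence, so its list is always a true
    prefix of [a]. *)
Lemma refutes_sound (A1 A2 A3 alpha : Q) (a : nat -> Z) :
  (forall n, (0 <= a n)%Z) ->
  (forall n, sum_f_R0 (fun i => flat_kernel (Q2R A1) (Q2R A2) (Q2R A3) (n - i)
      (Q2R alpha + INR i) * IZR (a i)) n + (Q2R alpha + INR n) ^ 4 * IZR (a n) = 0) ->
  forall fuel n, refutes A1 A2 A3 alpha fuel (S n) (prefix a (S n)) = false.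
Proof.
intros Ha H. induction fuel as [| fuel IH]; intros n; [easy |].
cbn [refutes].
set (I := indicial A1 A2 A3 (alpha + inject_Z (Z.of_nat (S n)))).
set (t := recurrence_sum A1 A2 A3 alpha (S n) (prefix a (S n))).
assert (E : (t + I * inject_Z (a (S n)) == 0)%Q).
{ apply eqR_Qeq. q2r. rewrite RMicromega.Q2R_0, <- (H (S n)), tech5. unfold t, I, indicial.
  rewrite Q2R_recurrence_sum. repeat (progress q2r). rewrite Q2R_flat_kernelQ.
  repeat (progress q2r). rewrite <- INR_IZR_INZ, Nat.sub_diag. ring. }
destruct (Qeq_bool I 0) eqn:EI.
(* At a zero of the indicial polynomial a_n is undetermined, but the equation still forces t = 0. *)
- apply Qeq_bool_iff in EI. rewrite EI in E.
  assert (Et : (t == 0)%Q) by (rewrite <- E; ring).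
  apply Qeq_bool_iff in Et. now rewrite Et.
- apply Qeq_bool_neq in EI.
  assert (Ev : Qred (- t / I) = inject_Z (a (S n))).
  { transitivity (Qred (inject_Z (a (S n)))).
    - apply Qred_complete. assert (Et : (t == - I * inject_Z (a (S n)))%Q).
      { rewrite <- (Qplus_0_r (- I * _)), <- E. ring. }
      rewrite Et. field. easy.
    - apply Qcanon.Qred_identity. simpl. apply Z.gcd_1_r. }
  rewrite Ev. simpl Qden. simpl Qnum.
  replace (Z.leb 0 (a (S n))) with true by (symmetry; apply Z.leb_le, Ha).
  simpl andb. apply (IH (S n)).
Qed.

(** * The finite list of candidates *)


Definition flat_recursive (s : C) (alpha : R) (a : nat -> Z) : Prop :=
  forall n, (RtoC (flat_coef0 alpha (fun i => IZR (a i)) n)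
     + alpha1 s * RtoC (flat_coef1 alpha (fun i => IZR (a i)) n)
     + alpha2 s * RtoC (flat_coef2 alpha (fun i => IZR (a i)) n)
     + alpha3 s * RtoC (flat_coef3 alpha (fun i => IZR (a i)) n) = 0)%C.

Definition alpha1R (s : R) : R := (- 25 * s ^ 2 + 120 * s + 1332) / 7200.
Definition alpha2R (s : R) : R := (5 * s + 6) ^ 2 / 14400.
Definition alpha3R (s : R) : R := (s - 18) * (s + 6) * (5 * s + 6) ^ 2 / 8294400.

Lemma alpha_RtoC (s : R) :
  alpha1 (RtoC s) = RtoC (alpha1R s) /\ alpha2 (RtoC s) = RtoC (alpha2R s)
  /\ alpha3 (RtoC s) = RtoC (alpha3R s).
Proof.
unfold alpha1, alpha2, alpha3, alpha1R, alpha2R, alpha3R.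
repeat split; apply injective_projections; simpl; field.
Qed.

Lemma flat_recursive_real (s alpha : R) (a : nat -> Z) :
  flat_recursive (RtoC s) alpha a -> forall n,
  sum_f_R0 (fun i => flat_kernel (alpha1R s) (alpha2R s) (alpha3R s) (n - i) (alpha + INR i)
    * IZR (a i)) n + (alpha + INR n) ^ 4 * IZR (a n) = 0.
Proof.
intros H n. specialize (H n). destruct (alpha_RtoC s) as [E1 [E2 E3]].
rewrite E1, E2, E3 in H. rewrite <- !RtoC_mult, <- !RtoC_plus in H. apply RtoC_inj in H.
now rewrite <- (flat_coef_sum _ _ _ alpha (fun i => IZR (a i)) n).
Qed.

Lemma indicial_roots (s : C) (alpha : R) (a : nat -> Z) :
  flat_recursive s alpha a -> a 0%nat = 1%Z ->
  s = RtoC (24 * alpha - 6 / 5) \/ s = RtoC (- 24 * alpha - 6 / 5)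
  \/ s = RtoC (24 * alpha - 6) \/ s = RtoC (18 - 24 * alpha).
Proof.
intros H Ha. specialize (H 0%nat).
unfold flat_coef0, flat_coef1, flat_coef2, flat_coef3, PS_mult, eis, qseries_coef, qshift in H.
simpl in H. rewrite Ha in H.
assert (E : ((s - RtoC (24 * alpha - 6 / 5)) * ((s - RtoC (- 24 * alpha - 6 / 5))
   * ((s - RtoC (24 * alpha - 6)) * (s - RtoC (18 - 24 * alpha)))) = 0)%C).
(* 331776 = 24^4 makes the degree-0 equation monic of degree 4 in s. *)
{ apply (f_equal (Cmult (RtoC 331776))) in H. rewrite Cmult_0_r in H. rewrite <- H.
  unfold alpha1, alpha2, alpha3. destruct s as [x y].
  apply injective_projections; simpl; field. }
assert (Hsub : forall z w : C, (z - w = 0)%C -> z = w).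
{ intros z w Hzw. rewrite <- (Cplus_0_r w), <- Hzw. ring. }
apply Cmult_integral in E. destruct E as [E | E]; [left; auto | right].
apply Cmult_integral in E. destruct E as [E | E]; [left; auto | right].
apply Cmult_integral in E. destruct E as [E | E]; [left; auto | right; auto].
Qed.

Lemma first_coefficient (s alpha : R) (a : nat -> Z) :
  flat_recursive (RtoC s) alpha a -> a 0%nat = 1%Z ->
  24 * alpha ^ 3 + (-72 + 240 * alpha1R s) * alpha ^ 2
  - (-24 + 120 * alpha1R s + 504 * alpha2R s) * alpha + 480 * alpha3R s
  + IZR (a 1%nat) * ((alpha + 1) ^ 4 - (alpha + 1) ^ 3 + alpha1R s * (alpha + 1) ^ 2
    + alpha2R s * (alpha + 1) + alpha3R s) = 0.
Proof.
intros H Ha. assert (H1 := flat_recursive_real _ _ _ H 1). simpl in H1. rewrite Ha in H1.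
unfold flat_kernel in H1. simpl in H1. rewrite <- H1. field.
Qed.

(** For y = p/q in lowest terms, q divides p^2, hence p, hence 1; then c = -p (p + b). *)
Lemma monic_quadratic_integral_root (y : Q) (b c : Z) :
  (y * y + inject_Z b * y + inject_Z c == 0)%Q ->
  exists z : Z, (y == inject_Z z)%Q /\ (z | c)%Z.
Proof.
intros H. rewrite <- (Qred_correct y) in H.
assert (Hg := Qcanon.Qred_identity2 _ (Qcanon.Qred_involutive y)).
setoid_rewrite <- (Qred_correct y) at 1.
destruct (Qred y) as [p q]. simpl in Hg.
unfold Qeq in H. simpl in H. rewrite ?Z.mul_1_r, ?Pos.mul_1_r, ?Pos2Z.inj_mul in H.
assert (H' : (p * p + b * p * Z.pos q + c * (Z.pos q * Z.pos q) = 0)%Z) by nia.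
assert (Hq : (Z.pos q | p)%Z).
{ apply Z.gauss with p; [| rewrite Z.gcd_comm; exact Hg].
  exists (- (b * p + c * Z.pos q))%Z. lia. }
assert (Hq1 : (Z.pos q | 1)%Z) by (rewrite <- Hg; apply Z.gcd_greatest; [easy | apply Z.divide_refl]).
apply Z.divide_1_r_nonneg in Hq1; [| lia].
exists p. split; [unfold Qeq; simpl; lia |].
exists (- (p + b))%Z. rewrite Hq1 in H'. lia.
Qed.

(** Rational copy of the final list, with every entry over 5, for comparison by computation. *)
Definition allowed : list Q :=
  map (fun n => n # 5)%Q
    (-318 :: -198 :: -138 :: -78 :: -48 :: -38 :: -18 :: -6 :: -3 :: 2 :: 6 :: 12 :: 18 :: 22
     :: 27 :: 30 :: 32 :: 54 :: 42 :: 90 :: -66 :: -30 :: -8 :: nil)%Z.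

(** The search starts from a_0 = 1, so fuel 32 tests a_1 up to a_32. *)
Definition settled (s alpha : Q) : bool :=
  existsb (Qeq_bool s) allowed
  || refutes (Qred (alpha1Q s)) (Qred (alpha2Q s)) (Qred (alpha3Q s)) alpha 32 1 (1%Z :: nil).

Fixpoint all_from (P : Z -> bool) (fuel : nat) (z : Z) : bool :=
  match fuel with O => true | S fuel' => P z && all_from P fuel' (z + 1) end.

(** Divisors of both signs are found among the 2c + 1 integers from -c to c. The nested conditionals
    prevent call-by-value reduction from running the costly [P] at other integers. *)
Definition all_divisors (P : Z -> bool) (c : Z) : bool :=
  all_from (fun z => if Z.eqb z 0 then true else if Z.eqb (Z.modulo c z) 0 then P z else true)
    (Z.to_nat (2 * c + 1)) (- c).

Lemma all_from_sound (P : Z -> bool) (fuel : nat) (z0 z : Z) :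
  all_from P fuel z0 = true -> (z0 <= z < z0 + Z.of_nat fuel)%Z -> P z = true.
Proof.
revert z0. induction fuel as [| fuel IH]; intros z0 H Hz; [lia |].
simpl in H. apply andb_prop in H. destruct H as [H1 H2].
destruct (Z.eq_dec z0 z) as [-> | Hne]; [easy |]. apply (IH (z0 + 1)%Z); [easy | lia].
Qed.

Lemma all_divisors_sound (P : Z -> bool) (c z : Z) :
  all_divisors P c = true -> (0 < c)%Z -> (z | c)%Z -> P z = true.
Proof.
intros H Hc Hz.
assert (z <= c)%Z by now apply Z.divide_pos_le.
assert (- z <= c)%Z by (apply Z.divide_pos_le, Z.divide_opp_l; easy).
apply (all_from_sound _ _ _ z) in H; [| lia]. cbv beta in H.
destruct (Z.eqb_spec z 0) as [E | E]; [destruct Hz as [k Hk]; lia |].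
rewrite (proj2 (Z.eqb_eq _ 0)) in H; [easy |]. now apply Z.mod_divide.
Qed.

Definition admissible : list R :=
    (-318/5 :: -198/5 :: -138/5 :: -78/5 :: -48/5 :: -38/5 :: -18/5 :: -6/5
     :: -3/5 :: 2/5 :: 6/5 :: 12/5 :: 18/5 :: 22/5 :: 27/5 :: 6 :: 32/5
     :: 54/5 :: 42/5 :: 18 :: -66/5 :: -6 :: -8/5 :: nil)%R.

Lemma allowed_correct (s : Q) :
  existsb (Qeq_bool s) allowed = true -> In (Q2R s) admissible.
Proof.
intros H. apply existsb_exists in H. destruct H as [x [Hx E]].
apply Qeq_bool_eq, Qeq_eqR in E. rewrite E. clear E s. revert x Hx.
apply Forall_forall. unfold allowed, Q2R; cbn [map].
repeat (apply Forall_cons; [simpl; repeat (first [left; lra | right]) |]).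
apply Forall_nil.
Qed.

Lemma Q2R_inv_pos (p : positive) : Q2R (1 # p) = / IZR (Z.pos p).
Proof. unfold Q2R; simpl. apply Rmult_1_l. Qed.

Lemma settled_sound (s alpha : Q) (a : nat -> Z) :
  flat_recursive (RtoC (Q2R s)) (Q2R alpha) a -> a 0%nat = 1%Z -> (forall n, (0 <= a n)%Z) ->
  settled s alpha = true -> In (Q2R s) admissible.
Proof.
intros H Ha0 Ha Hs. unfold settled in Hs. apply Bool.orb_prop in Hs. destruct Hs as [Hs | Hs].
- now apply allowed_correct.
- exfalso. assert (Hr := flat_recursive_real _ _ _ H).
  replace (1%Z :: nil) with (prefix a 1) in Hs by (simpl; now rewrite Ha0).
  rewrite refutes_sound in Hs; [easy | easy |].
  replace (Q2R (Qred (alpha1Q s))) with (alpha1R (Q2R s)).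
  replace (Q2R (Qred (alpha2Q s))) with (alpha2R (Q2R s)).
  replace (Q2R (Qred (alpha3Q s))) with (alpha3R (Q2R s)).
  + exact Hr.
  + unfold alpha3Q, alpha3R. repeat (progress q2r). rewrite Q2R_inv_pos. field.
  + unfold alpha2Q, alpha2R. repeat (progress q2r). rewrite Q2R_inv_pos. field.
  + unfold alpha1Q, alpha1R. repeat (progress q2r). rewrite Q2R_inv_pos. field.
Qed.

(** The argument common to the four branches: y is an affine function of alpha, and [sQ], [alphaQ]
    recover s and alpha from its integer value. *)
Lemma divisor_branch (s : R) (alpha y : Q) (a : nat -> Z) (b c : Z) (sQ alphaQ : Z -> Q) :
  flat_recursive (RtoC s) (Q2R alpha) a -> a 0%nat = 1%Z -> (forall n, (0 <= a n)%Z) ->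
  all_divisors (fun z => settled (sQ z) (alphaQ z)) c = true -> (0 < c)%Z ->
  Q2R y ^ 2 + IZR b * Q2R y + IZR c = 0 ->
  (forall z, Q2R y = IZR z -> s = Q2R (sQ z) /\ Q2R alpha = Q2R (alphaQ z)) ->
  In s admissible.
Proof.
intros H Ha0 Ha Hall Hc Hy Hz.
destruct (monic_quadratic_integral_root y b c) as [z [Ez Hdiv]].
{ apply eqR_Qeq. repeat (progress q2r). rewrite RMicromega.Q2R_0, <- Hy. ring. }
apply Qeq_eqR in Ez. rewrite Q2R_inject_Z in Ez. destruct (Hz z Ez) as [Es Ealpha].
rewrite Es, Ealpha in H. rewrite Es. apply (settled_sound _ _ _ H Ha0 Ha).
exact (all_divisors_sound _ c z Hall Hc Hdiv).
Qed.

(** Branch s = 24 alpha - 6/5, with z = 120 alpha + 12 = 5s + 18. *)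
Lemma divisors_180_settled :
  all_divisors (fun z => settled ((z - 18) # 5) ((z - 12) # 120)) 180 = true.
Proof. vm_compute. reflexivity. Qed.

(** Branch s = -24 alpha - 6/5, with z = -120 alpha - 48 = 5s - 42. *)
Lemma divisors_2880_settled :
  all_divisors (fun z => settled ((z + 42) # 5) ((- z - 48) # 120)) 2880 = true.
Proof. vm_compute. reflexivity. Qed.

(** Branch s = 24 alpha - 6, with z = 120 alpha + 48 = 5s + 78. *)
Lemma divisors_4200_settled :
  all_divisors (fun z => settled ((z - 78) # 5) ((z - 48) # 120)) 4200 = true.
Proof. vm_compute. reflexivity. Qed.

(** Branch s = 18 - 24 alpha, with z = -360 alpha - 36 = 15s - 306. *)
Lemma divisors_100800_settled :
  all_divisors (fun z => settled ((z + 306) # 15) ((- z - 36) # 360)) 100800 = true.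
Proof. vm_compute. reflexivity. Qed.

Ltac find_admissible := simpl; repeat (first [left; lra | right]).

Ltac q2r_fractions :=
  unfold Q2R; simpl Qnum; simpl Qden; rewrite ?minus_IZR, ?plus_IZR, ?opp_IZR.

(** On each branch the factor of a_1, the indicial polynomial at alpha + 1, is up to a constant a
    product of two affine functions of alpha. One divides the whole degree-1 equation; the other,
    suitably scaled, is z, so a_1 enters the remaining quadratic only in its linear coefficient. *)
Lemma flat_recursive_admissible (s : C) (alpha : Q) (a : nat -> Z) :
  flat_recursive s (Q2R alpha) a -> a 0%nat = 1%Z -> (forall n, (0 <= a n)%Z) ->
  In s (map RtoC admissible).
Proof.
intros H Ha0 Ha.
destruct (indicial_roots s _ a H Ha0) as [E | [E | [E | E]]]; rewrite E in H |- *;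
  apply in_map; assert (H1 := first_coefficient _ _ _ H Ha0);
  unfold alpha1R, alpha2R, alpha3R in H1.
(* The cancelled factor vanishes at alpha = -1/2, where s = -66/5. The multiplier -4500 below, like
   its analogues, normalizes the equation to this product. *)
- destruct (Rmult_integral (120 * Q2R alpha + 60)
    ((120 * Q2R alpha + 12) ^ 2 + (- 27 - IZR (a 1%nat)) * (120 * Q2R alpha + 12) + 180))
    as [E1 | E1].
  + apply (f_equal (Rmult (- 4500))) in H1. rewrite Rmult_0_r in H1. rewrite <- H1. field.
  + find_admissible.
  + apply (divisor_branch _ alpha (inject_Z 120 * alpha + inject_Z 12) a (- 27 - a 1%nat) 180 _ _
      H Ha0 Ha divisors_180_settled); [lia | |].
    * repeat (progress q2r). rewrite minus_IZR, <- E1. ring.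
    * intros z. repeat (progress q2r). intros Ez. q2r_fractions. rewrite <- Ez. unfold Q2R. lra.
(* Here alpha = -1/2 gives s = 54/5. *)
- destruct (Rmult_integral (- 120 * Q2R alpha - 60)
    ((- 120 * Q2R alpha - 48) ^ 2 + (108 + IZR (a 1%nat)) * (- 120 * Q2R alpha - 48) + 2880))
    as [E1 | E1].
  + apply (f_equal (Rmult 18000)) in H1. rewrite Rmult_0_r in H1. rewrite <- H1. field.
  + find_admissible.
  + apply (divisor_branch _ alpha (inject_Z (- 120) * alpha - inject_Z 48) a (108 + a 1%nat) 2880 _ _
      H Ha0 Ha divisors_2880_settled); [lia | |].
    * repeat (progress q2r). rewrite plus_IZR, <- E1. ring.
    * intros z. repeat (progress q2r). intros Ez. q2r_fractions. rewrite <- Ez. unfold Q2R. lra.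
(* Here alpha = 0 gives s = -6. *)
- destruct (Rmult_integral (120 * Q2R alpha)
    ((120 * Q2R alpha + 48) ^ 2 + (- 130 - IZR (a 1%nat)) * (120 * Q2R alpha + 48) + 4200))
    as [E1 | E1].
  + apply (f_equal (Rmult (- 3000))) in H1. rewrite Rmult_0_r in H1. rewrite <- H1. field.
  + find_admissible.
  + apply (divisor_branch _ alpha (inject_Z 120 * alpha + inject_Z 48) a (- 130 - a 1%nat) 4200 _ _
      H Ha0 Ha divisors_4200_settled); [lia | |].
    * repeat (progress q2r). rewrite minus_IZR, <- E1. ring.
    * intros z. repeat (progress q2r). intros Ez. q2r_fractions. rewrite <- Ez. unfold Q2R. lra.
(* Here alpha = 0 gives s = 18. In -120 alpha - 12 the quadratic would have leading coefficient 3;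
   tripling the variable makes it monic. *)
- destruct (Rmult_integral (- 120 * Q2R alpha)
    ((- 360 * Q2R alpha - 36) ^ 2 + (632 + 3 * IZR (a 1%nat)) * (- 360 * Q2R alpha - 36) + 100800))
    as [E1 | E1].
  + apply (f_equal (Rmult 18000)) in H1. rewrite Rmult_0_r in H1. rewrite <- H1. field.
  + find_admissible.
  + apply (divisor_branch _ alpha (inject_Z (- 360) * alpha - inject_Z 36) a (632 + 3 * a 1%nat)
      100800 _ _ H Ha0 Ha divisors_100800_settled); [lia | |].
    * repeat (progress q2r). rewrite plus_IZR, mult_IZR, <- E1. ring.
    * intros z. repeat (progress q2r). intros Ez. q2r_fractions. rewrite <- Ez. unfold Q2R. lra.
Qed.

Theorem mainTheorem5 (s : C)
  (hs : exists f : C -> C, flat_solution s f /\ CFT_type f) :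
  In s (map RtoC
    (-318/5 :: -198/5 :: -138/5 :: -78/5 :: -48/5 :: -38/5 :: -18/5 :: -6/5
     :: -3/5 :: 2/5 :: 6/5 :: 12/5 :: 18/5 :: 22/5 :: 27/5 :: 6 :: 32/5
     :: 54/5 :: 42/5 :: 18 :: -66/5 :: -6 :: -8/5 :: nil)%R).
Proof.
destruct hs as [f [Hf [alpha [a Ha]]]].
destruct (CFT_type_qseries f (Q2R alpha) a Ha) as [Hsub Heq].
apply (flat_recursive_admissible s alpha (monic_coef a)).
- exact (flat_recurrence s f (Q2R alpha) _ Hf Hsub Heq).
- reflexivity.
- intros [| n]; simpl; lia.
Qed.
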